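(* Let $n=2$, $m=2$, $p=1$, $\mathcal{W}=\{0\}$, $\mathcal{U}=\{-1,3\}$, $B=\begin{pmatrix}1&3\\1&-1\end{pmatrix}$, and let $D\in\mathbb{Z}^{2\times 1}$ be arbitrary. Consider the system $x(t+1)=x(t)+Bu(t)-Dw(t)$, $t\in\mathbb{Z}_+$, with state $x(t)\in\mathbb{R}^2$, control input $u(t)\in\mathcal{U}^2$ and disturbance input $w(t)\in\mathcal{W}$. Then the condition ''$\mathcal{U}_z^*\neq\emptyset$ for all $z\in\mathbb{B}^2$'' does not hold (indeed $\mathcal{U}^*_{(0,0)}=\mathcal{U}^*_{(1,0)}=\mathcal{U}^*_{(1,1)}=\emptyset$), yet the hyperbox $X=[0,24]\times[0,8]$ is both robustly control invariant and robustly globally attractive. Moreover, with $u_1=(-1,-1)^T$, $u_2=(-1,3)^T$, $u_3=(3,-1)^T$, $u_4=(3,3)^T$, the control law $\varphi:\mathbb{R}^2\to\mathcal{U}^2$ defined by $$\varphi(x)=\begin{cases}u_1 & \text{if } [x]_1\ge 12,\ 0\le[x]_2\le 8,\\ u_4 & \text{if } [x]_1<12,\ 0\le[x]_2\le 8,\\ u_3 & \text{if } [x]_2<0,\\ u_2 & \text{if } [x]_2>8\end{cases}$$ renders $X$ robustly control invariant (via its restriction to $X$) and robustly globally attractive (via its restriction to $\mathbb{R}^2\setminus X$).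
   Context: $\mathbb{Z}_+$ denotes the non-negative integers, $[x]_i$ the $i$-th component of a vector $x$, and $\mathbb{B}^n=\{0,1\}^n$. For $i\in\{1,\dots,n\}$ define $\mathcal{U}_{+*}^i=\{u\in\mathcal{U}^m : [Bu-Dw]_i> 0\ \forall w\in\mathcal{W}^p\}$ and $\mathcal{U}_{-*}^i=\{u\in\mathcal{U}^m : [Bu-Dw]_i< 0\ \forall w\in\mathcal{W}^p\}$. The signature of $x\in\mathbb{R}_+^n$ (non-negative entries) is the $n$-tuple $(s_1,\dots,s_n)$ with $s_i=+$ if $[x]_i=0$ and $s_i=-$ if $[x]_i>0$. For $x$ with signature $(s_1,\dots,s_n)$, $\mathcal{U}_x^*=\mathcal{U}_{s_1*}^1\cap\cdots\cap\mathcal{U}_{s_n*}^n$. A hyperbox $X\subset\mathbb{R}^n$ is robustly control invariant if there exists a control law $\varphi:X\to\mathcal{U}^m$ such that for every $x\in X$ and every $w\in\mathcal{W}^p$, $x+B\varphi(x)-Dw\in X$; such a $\varphi$ is said to render $X$ robustly control invariant. $X$ is robustly globally attractive if there exists a control law $\psi:\mathbb{R}^n\setminus X\to\mathcal{U}^m$ such that for every initial condition $x(0)\in\mathbb{R}^n\setminus X$ and every disturbance $w:\mathbb{Z}_+\to\mathcal{W}^p$, the corresponding state trajectory (given by $x(t+1)=x(t)+B\psi(x(t))-Dw(t)$ as long as $x(t)\in\mathbb{R}^n\setminus X$) satisfies $x(\tau)\in X$ for some $\tau\in\mathbb{Z}_+$; such a $\psi$ is said to render $X$ robustly globally attractive.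 *)

(* Defs.v *)
From HB Require Import structures.
From mathcomp Require Import all_boot all_order all_algebra.
From mathcomp Require Import classical_sets reals.

Set Implicit Arguments.
Unset Strict Implicit.
Unset Printing Implicit Defensive.

Import Order.TTheory GRing.Theory Num.Theory.
Local Open Scope classical_set_scope.
Local Open Scope ring_scope.

Inductive sign := Plus | Minus.

Definition vecs (R : realType) (k : nat) (A : set R) : set 'cV[R]_k :=
  [set v | forall i, A (v i 0)].

Definition hyperbox (R : realType) (n : nat) (a b : 'cV[R]_n) : set 'cV[R]_n :=
  [set x | forall i, a i 0 <= x i 0 <= b i 0].

Definition binary_vecs (R : realType) (n : nat) : set 'cV[R]_n :=
  vecs [set 0; 1].

(* Only meaningful for vectors with non-negative entries. *)
Definition signature (R : realType) (n : nat) (x : 'cV[R]_n) (i : 'I_n) : sign :=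
  if x i 0 == 0 then Plus else Minus.

Section System.

(* The system x(t+1) = x(t) + B u(t) - D w(t), with u(t) in U^m and w(t) in
   W^p. *)
Variables (R : realType) (n m p : nat).
Variables (B : 'M[R]_(n, m)) (D : 'M[R]_(n, p)) (U W : set R).

Definition step (x : 'cV[R]_n) (u : 'cV[R]_m) (w : 'cV[R]_p) : 'cV[R]_n :=
  x + B *m u - D *m w.

Definition U_sign (s : sign) (i : 'I_n) : set 'cV[R]_m :=
  [set u | vecs U u /\
    forall w, vecs W w ->
      match s with
      | Plus => (B *m u - D *m w) i 0 > 0
      | Minus => (B *m u - D *m w) i 0 < 0
      end].

Definition U_star (x : 'cV[R]_n) : set 'cV[R]_m :=
  \bigcap_(i in [set: 'I_n]) U_sign (signature x i) i.

(* A control law Y -> U^m is represented by a total function of which only the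
   values on Y matter; restricting a law to a subset of Y is then implicit. *)
Definition control_law_on (Y : set 'cV[R]_n) (f : 'cV[R]_n -> 'cV[R]_m) : Prop :=
  forall x, Y x -> vecs U (f x).

Definition renders_invariant (X : set 'cV[R]_n) (phi : 'cV[R]_n -> 'cV[R]_m) :
    Prop :=
  control_law_on X phi /\
  forall x w, X x -> vecs W w -> X (step x (phi x) w).

Definition robustly_control_invariant (X : set 'cV[R]_n) : Prop :=
  exists phi, renders_invariant X phi.

(* The recursion is only imposed as long as the state lies outside X; what the
   sequence does after entering X is irrelevant. *)
Definition trajectory_outside (X : set 'cV[R]_n) (psi : 'cV[R]_n -> 'cV[R]_m)
    (w : nat -> 'cV[R]_p) (x : nat -> 'cV[R]_n) : Prop :=
  forall t, ~ X (x t) -> x t.+1 = step (x t) (psi (x t)) (w t).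

Definition renders_attractive (X : set 'cV[R]_n) (psi : 'cV[R]_n -> 'cV[R]_m) :
    Prop :=
  control_law_on (~` X) psi /\
  forall (w : nat -> 'cV[R]_p) (x : nat -> 'cV[R]_n),
    (forall t, vecs W (w t)) -> ~ X (x 0%N) ->
    trajectory_outside X psi w x ->
    exists tau, X (x tau).

Definition robustly_globally_attractive (X : set 'cV[R]_n) : Prop :=
  exists psi, renders_attractive X psi.

End System.

Definition vec2 (R : realType) (a b : R) : 'cV[R]_2 := \col_i [:: a; b]`_i.

Definition B_ex (R : realType) : 'M[R]_(2, 2) :=
  \matrix_(i, j) (nth [::] [:: [:: 1;  3];
                               [:: 1; -1]] i)`_j.

Definition phi_ex (R : realType) (x : 'cV[R]_2) : 'cV[R]_2 :=
  let u1 := vec2 (-1) (-1) in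
  let u2 := vec2 (-1) 3 in
  let u3 := vec2 3 (-1) in
  let u4 := vec2 3 3 in
  let x1 := x 0 0 in
  let x2 := x 1 0 in
  if (x1 >= 12) && (0 <= x2 <= 8) then u1
  else if (x1 < 12) && (0 <= x2 <= 8) then u4
  else if x2 < 0 then u3
  else (* x2 > 8 *) u2.

(* Main.v *)
Require Import Defs.
From mathcomp Require Import all_boot all_order all_algebra.
From mathcomp Require Import classical_sets reals.
From mathcomp Require Import boolp lra.

Import Order.TTheory GRing.Theory Num.Theory.

Local Open Scope classical_set_scope.
Local Open Scope ring_scope.

(** Since the disturbance is zero, the dynamics only involves the four
    displacements [B u1 = (-4, 0)], [B u2 = (8, -4)], [B u3 = (0, 4)] and
    [B u4 = (12, 0)].  No displacement is positive in both coordinates or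
    negative in both, and the only one with a negative first coordinate,
    [B u1], has second coordinate zero; hence the three empty control sets.

    The law nevertheless works because the coordinates can be steered one after
    the other.  Outside the strip [0 <= x2 <= 8], the second coordinate moves
    towards the strip by 4, which is less than the width 8, so that it cannot
    jump over the strip.  Inside the strip, [x2] is frozen, while [x1] moves by
    12 to the right when [x1 < 12] and by 4 to the left when [x1 >= 12]: this
    preserves [0, 24], and moves any point outside [0, 24] towards it by at
    least 4 without jumping over it.  Both phases end by the same Archimedean
    argument, [enters_interval]; chaining them gives [phi_attractive]. *)

(** * Termination of a one-dimensional motion towards an interval *)

(** A step from outside cannot overshoot [0, h], and unless it lands inside it
    brings [y] closer by at least [d]. *)
Lemma enters_interval {R : archiRealFieldType} (d h : R) (y : nat -> R) :
  0 < d ->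
  (forall t, y t < 0 -> y t + d <= y t.+1 <= h) ->
  (forall t, h < y t -> 0 <= y t.+1 <= y t - d) ->
  exists t, 0 <= y t <= h.
Proof.
move=> d0 ylo yhi.
have within k : forall t, - (d *+ k) <= y t <= h + d *+ k ->
    exists s, 0 <= y s <= h.
  elim: k => [|k IHk] t; first by rewrite mulr0n oppr0 addr0; exists t.
  rewrite mulrS => /andP[lo hi].
  have dk0 : 0 <= d *+ k by rewrite mulrn_wge0 // ltW.
  have [y_lt0|y_ge0] := ltP (y t) 0.
    by have /andP[? ?] := ylo t y_lt0; apply: (IHk t.+1); lra.
  have [h_lty|y_leh] := ltP h (y t).
    by have /andP[? ?] := yhi t h_lty; apply: (IHk t.+1); lra.
  by exists t; rewrite y_ge0.
have [k kP] : exists k, `|y 0%N| + `|h| <= d *+ k.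
  exists (Num.bound ((`|y 0%N| + `|h|) / d)).
  rewrite -mulr_natl -ler_pdivrMr //.
  by apply/ltW/archi_boundP; rewrite divr_ge0 ?addr_ge0 // ltW.
apply: (within k 0%N).
have := ler_norm (y 0%N); have := ler_norm (- y 0%N).
have := ler_norm (- h); rewrite !normrN.
have := normr_ge0 h; have := normr_ge0 (y 0%N).
by lra.
Qed.

(** * The displacements of the four controls *)

Section Example.
Variable R : realType.
Variable D : 'M[R]_(2, 1).
Implicit Types (a b : R) (x u : 'cV[R]_2) (w : 'cV[R]_1).

Local Notation U := [set -1; 3 : R].
Local Notation W := [set 0 : R].
Local Notation X := (hyperbox (vec2 0 0) (vec2 24 8) : set 'cV[R]_2).
Local Notation B := (B_ex R).
Local Notation phi := (@phi_ex R).

Lemma forall_I2 (P : 'I_2 -> Prop) : (forall i, P i) <-> P 0 /\ P 1.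
Proof.
split=> [HP|[P0 P1] [[|[|//]] lt_i2]]; first by split.
- by rewrite (_ : Ordinal lt_i2 = 0) //; apply: val_inj.
- by rewrite (_ : Ordinal lt_i2 = 1) //; apply: val_inj.
Qed.

Lemma sum_I2 (F : 'I_2 -> R) : \sum_i F i = F 0 + F 1.
Proof.
rewrite big_ord_recl big_ord1; congr (_ + F _).
exact: val_inj.
Qed.

Lemma vecs2P (A : set R) u : vecs A u <-> A (u 0 0) /\ A (u 1 0).
Proof. exact: (forall_I2 (fun i => A (u i 0))). Qed.

Lemma vec2_0 a b : vec2 a b 0 0 = a. Proof. by rewrite mxE. Qed.

Lemma vec2_1 a b : vec2 a b 1 0 = b. Proof. by rewrite mxE. Qed.

Lemma B_ex_mul0 u : (B *m u) 0 0 = u 0 0 + 3 * u 1 0.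
Proof. by rewrite mxE sum_I2 !mxE /= mul1r. Qed.

Lemma B_ex_mul1 u : (B *m u) 1 0 = u 0 0 - u 1 0.
Proof. by rewrite mxE sum_I2 !mxE /= mul1r mulN1r. Qed.

Lemma hyperboxXP x : X x <-> 0 <= x 0 0 <= 24 /\ 0 <= x 1 0 <= 8.
Proof.
have := forall_I2 (fun i => is_true (vec2 0 0 i 0 <= x i 0 <= vec2 24 8 i 0)).
by rewrite !vec2_0 !vec2_1.
Qed.

Lemma zero_disturbance w : vecs W w -> w = 0.
Proof. by move=> w0; apply/colP => i; rewrite mxE; exact: w0. Qed.

Lemma step_phi0 x w : vecs W w ->
  step B D x (phi x) w 0 0 = x 0 0 + (phi x 0 0 + 3 * phi x 1 0).
Proof.
by move/zero_disturbance ->; rewrite /step mulmx0 subr0 mxE B_ex_mul0.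
Qed.

Lemma step_phi1 x w : vecs W w ->
  step B D x (phi x) w 1 0 = x 1 0 + (phi x 0 0 - phi x 1 0).
Proof.
by move/zero_disturbance ->; rewrite /step mulmx0 subr0 mxE B_ex_mul1.
Qed.

(** * Emptiness of the control sets *)

Lemma U_star_signs z u : U_star B D U W z u ->
  [/\ vecs U u,
      if z 0 0 == 0 then 0 < u 0 0 + 3 * u 1 0 else u 0 0 + 3 * u 1 0 < 0 &
      if z 1 0 == 0 then 0 < u 0 0 - u 1 0 else u 0 0 - u 1 0 < 0].
Proof.
move=> zu; have W0 : vecs W (0 : 'cV[R]_1) by move=> i; rewrite mxE.
have [Uu /(_ _ W0) z0] := zu 0 I; have [_ /(_ _ W0) z1] := zu 1 I.
move: z0 z1; rewrite /signature mulmx0 subr0 B_ex_mul0 B_ex_mul1.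
by split=> //; [move: z0 | move: z1]; case: ifP.
Qed.

(** The excluded pattern, [a = 0] and [b <> 0], asks for a positive first and a
    negative second displacement; it is the one achieved, by [u2]. *)
Lemma U_star_empty a b : ~~ ((a == 0) && (b != 0)) -> U_star B D U W (vec2 a b) = set0.
Proof.
move=> ab; apply/seteqP; split=> // u /U_star_signs[/vecs2P[u0 u1]].
rewrite vec2_0 vec2_1; move: ab.
by case: (a == 0); case: (b == 0) => //= _; move: u0 u1 => [] -> [] ->; lra.
Qed.

(** * The switching law *)

Lemma phi_in_U x : vecs U (phi x).
Proof.
rewrite /phi_ex; apply/vecs2P.
by do 3?case: ifP => _; rewrite vec2_0 vec2_1; split; by [left | right].
Qed.

(** In [0, 24], a move by -4 is safe from 12 upwards and a move by 12 is safe
    below 12; both leave the second coordinate unchanged. *)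
Lemma phi_invariant : renders_invariant B D U W X phi.
Proof.
split=> [x _|x w /hyperboxXP[x0 x1] Ww]; first exact: phi_in_U.
apply/hyperboxXP; rewrite step_phi0 // step_phi1 // /phi_ex x1 !andbT.
by have [?|?] := leP 12 (x 0 0); rewrite vec2_0 vec2_1; split; lra.
Qed.

(** If the trajectory never met [X], the recursion would hold at all times, and
    [enters_interval] applied to [x2] from time 0, then to [x1] from the entry
    time [t0] into the strip, would bring it into [X]. *)
Lemma phi_attractive : renders_attractive B D U W X phi.
Proof.
split=> [x _|w x Ww _ traj]; first exact: phi_in_U.
apply: contrapT => /forallNP avoid.
have next0 t : x t.+1 0 0 = x t 0 0 + (phi (x t) 0 0 + 3 * phi (x t) 1 0).
  by rewrite traj ?step_phi0.
have next1 t : x t.+1 1 0 = x t 1 0 + (phi (x t) 0 0 - phi (x t) 1 0).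
  by rewrite traj ?step_phi1.
have [t0 strip0] : exists t, 0 <= x t 1 0 <= 8.
  apply: (@enters_interval R 4) => // t out; rewrite next1 /phi_ex.
  - have -> : (0 <= x t 1 0 <= 8) = false by apply/negbTE; lra.
    by rewrite !andbF out vec2_0 vec2_1; lra.
  - have -> : (0 <= x t 1 0 <= 8) = false by apply/negbTE; lra.
    have -> : (x t 1 0 < 0) = false by apply/negbTE; lra.
    by rewrite !andbF vec2_0 vec2_1; lra.
(* Inside the strip the law uses [u1] and [u4], which freeze [x2]. *)
have strip k : 0 <= x (t0 + k)%N 1 0 <= 8.
  elim: k => [|k IHk]; first by rewrite addn0.
  rewrite addnS next1 /phi_ex IHk !andbT.
  by have [?|?] := leP 12 (x (t0 + k)%N 0 0); rewrite vec2_0 vec2_1; lra.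
have [k xk] : exists k, 0 <= x (t0 + k)%N 0 0 <= 24.
  apply: (@enters_interval R 4 24 (fun k => x (t0 + k)%N 0 0)) => // k out;
    rewrite addnS next0 /phi_ex strip !andbT.
  - have -> : (12 <= x (t0 + k)%N 0 0) = false by apply/negbTE; lra.
    have -> : x (t0 + k)%N 0 0 < 12 by lra.
    by rewrite vec2_0 vec2_1; lra.
  - have -> : 12 <= x (t0 + k)%N 0 0 by lra.
    by rewrite vec2_0 vec2_1; lra.
by apply: (avoid (t0 + k)%N); apply/hyperboxXP.
Qed.

End Example.

Theorem mainTheorem3 (R : realType) (D : 'M[int]_(2, 1)) :
  let B : 'M[R]_(2, 2) := B_ex R in
  let D' : 'M[R]_(2, 1) := map_mx intr D in
  let U : set R := [set -1; 3] in
  let W : set R := [set 0] in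
  let X : set 'cV[R]_2 := hyperbox (vec2 0 0) (vec2 24 8) in
  ~ (forall z, binary_vecs z -> U_star B D' U W z !=set0) /\
  U_star B D' U W (vec2 0 0) = set0 /\
  U_star B D' U W (vec2 1 0) = set0 /\
  U_star B D' U W (vec2 1 1) = set0 /\
  robustly_control_invariant B D' U W X /\
  robustly_globally_attractive B D' U W X /\
  renders_invariant B D' U W X (@phi_ex R) /\
  renders_attractive B D' U W X (@phi_ex R).
Proof.
move=> B D' U W X.
have U00 : U_star B D' U W (vec2 0 0) = set0.
  by apply: U_star_empty; rewrite eqxx.
split.
  move=> /(_ (vec2 0 0)); rewrite U00 => H.
  by have [|u []] := H; apply/vecs2P; rewrite vec2_0 vec2_1; split; left.
split=> //; split; first by apply: U_star_empty; rewrite oner_eq0.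
split; first by apply: U_star_empty; rewrite oner_eq0.
split; first by exists (@phi_ex R); exact: phi_invariant.
split; first by exists (@phi_ex R); exact: phi_attractive.
by split; [exact: phi_invariant | exact: phi_attractive].
Qed.
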